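(* Fix $\rho\in(1,\infty)$ and let $F$ be a mixed graph with at least one directed edge and $\theta(F)\in(1,\infty)$. Then \[\limsup_{n\to\infty}\ \max_{\substack{v(G)=n\\ F\not\subseteq G}}\frac{w_\rho(G)}{\binom n2}=\max_{B\in\mathcal M_F}g_\rho(B).\]
   Context: Mixed graphs: finite vertex set, at most one edge on each pair of distinct vertices, each edge undirected or directed (tail $\to$ head). A head (tail) vertex is the head (tail) of some directed edge. $\alpha(G),\beta(G)$ are the numbers of undirected and directed edges divided by $\binom{v(G)}2$; $w_\rho(G)=e_u(G)+\rho\, e_d(G)$ where $e_u,e_d$ are the numbers of undirected and directed edges. $F\subseteq G$ means there is an injection $V(F)\to V(G)$ sending undirected edges of $F$ to edges of either type of $G$ and each directed edge $u\to v$ of $F$ to the directed edge $\phi(u)\to\phi(v)$ of $G$. $\theta(F)$ is the maximum $\rho$ with $\limsup_n\max\{\alpha(G)+\rho\beta(G):G\ F\text{-free},\ v(G)=n\}\le1$ ($\theta(F)=\infty$ if $\max\beta(G)\to0$). $F$ is collapsible if no two head vertices are adjacent and no two tail vertices are adjacent. For collapsible $F$ with a directed edge, $F^\rhd$ is obtained by contracting all head vertices to one vertex $h$ and all tail vertices to one vertex $t$ (keeping $F$ on the other vertices, joining $w$ to $h$ (resp. $t$) by an undirected edge iff $w$ was adjacent to some head (resp. tail) vertex, and adding the directed edge $t\to h$). $\chi(\cdot)$ is the chromatic number of the underlying undirected graph. A mixed adjacency matrix of size $r$ is a pair $A=(U,D)$ of $r\times r$ matrices with $U$ symmetric 0/1,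 $D_{ij}\in\{0,2\}$, $D_{ij}\ne0\Rightarrow D_{ji}=0$, and at most one of $U_{ij},D_{ij}$ nonzero for all $i,j$. For $\mathbf x\in\mathbb Z_{\ge0}^r$, $A[\![\mathbf x]\!]$ has vertex set $W_1\sqcup\dots\sqcup W_r$, $|W_i|=x_i$; $W_i$ is an undirected clique if $U_{ii}=1$, else independent; for $i\ne j$, complete undirected between $W_i,W_j$ if $U_{ij}=1$, all directed edges from $W_i$ to $W_j$ if $D_{ij}=2$, none otherwise. $\Delta_r$ is the standard simplex in $\mathbb R^r$, $A_\rho=U+\rho D$, $g_\rho(A)=\max_{\mathbf y\in\Delta_r}\mathbf y^\intercal A_\rho\mathbf y$. $K=([1],[0])$. $\mathcal M_F$ is $\{K\}$ together with all mixed adjacency matrices $A=(U,D)$ of size $r$ with: $F\not\subseteq A[\![t\mathbf 1]\!]$ for all $t\in\mathbb Z_{>0}$; $r\le\chi(F^\rhd)-1$; $U_{ii}=0$ for all $i$; $D\ne0$; $U_{ij}+U_{ji}+D_{ij}+D_{ji}>0$ for all $i\ne j$. *)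

(* Defs.v *)
From HB Require Import structures.
From mathcomp Require Import all_boot all_order all_algebra.
From mathcomp Require Import all_classical all_reals all_analysis.
Import Order.TTheory GRing.Theory Num.Theory.
Import numFieldNormedType.Exports.

Set Implicit Arguments.
Unset Strict Implicit.
Unset Printing Implicit Defensive.

Local Open Scope ring_scope.

(* A mixed graph on T: a set of undirected edges (unordered pairs) and a set
   of directed edges, (x, y) standing for x -> y (tail x, head y), with at
   most one edge on each pair of distinct vertices. *)
Definition mgraph_axiom (T : finType) (E : {set {set T}} * {set T * T}) : bool :=
  [forall e in E.1, #|e| == 2%N] &&
  [forall p in E.2, [&& p.1 != p.2, (p.2, p.1) \notin E.2
                      & [set p.1; p.2] \notin E.1]].

Record mgraph (T : finType) := MGraph {
  mgraph_val : {set {set T}} * {set T * T};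
  mgraph_valP : mgraph_axiom mgraph_val }.

HB.instance Definition _ (T : finType) := [isSub for @mgraph_val T].
HB.instance Definition _ (T : finType) := [Countable of mgraph T by <:].
HB.instance Definition _ (T : finType) := [Finite of mgraph T by <:].

Definition uedges (T : finType) (G : mgraph T) : {set {set T}} :=
  (mgraph_val G).1.
Definition dedges (T : finType) (G : mgraph T) : {set T * T} :=
  (mgraph_val G).2.

Definition uadj (T : finType) (G : mgraph T) : rel T :=
  fun x y => [set x; y] \in uedges G.
Definition dadj (T : finType) (G : mgraph T) : rel T :=
  fun x y => (x, y) \in dedges G.
Definition madj (T : finType) (G : mgraph T) : rel T :=
  fun x y => [|| uadj G x y, dadj G x y | dadj G y x].

Lemma madj_irrefl (T : finType) (G : mgraph T) : irreflexive (madj G).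
Proof.
case/andP: (mgraph_valP G) => /forall_inP hU /forall_inP hD x.
rewrite /madj orbb; apply/norP; split; apply/negP.
  by move=> /hU; rewrite finset.setUid cards1.
by move=> /hD /and3P[]; rewrite eqxx.
Qed.

Definition is_head (T : finType) (G : mgraph T) (v : T) : bool :=
  [exists u, dadj G u v].
Definition is_tail (T : finType) (G : mgraph T) (v : T) : bool :=
  [exists u, dadj G v u].

Definition mgraph_sub (V W : finType) (F : mgraph V) (G : mgraph W) : bool :=
  [exists f : {ffun V -> W},
    [&& injectiveb f,
        [forall x, forall y, uadj F x y ==> madj G (f x) (f y)]
      & [forall x, forall y, dadj F x y ==> dadj G (f x) (f y)]]].

Definition mcolorable (T : finType) (G : mgraph T) (k : nat) : bool :=
  [exists c : {ffun T -> 'I_k},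
    [forall x, forall y, madj G x y ==> (c x != c y)]].

Lemma mcolorable_ex (T : finType) (G : mgraph T) : exists k, mcolorable G k.
Proof.
exists #|T|; apply/existsP; exists [ffun x => enum_rank x].
apply/forallP => x; apply/forallP => y; apply/implyP => xy.
rewrite !ffunE (inj_eq enum_rank_inj); apply: contraTneq xy => ->.
by rewrite madj_irrefl.
Qed.

Definition chromatic_number (T : finType) (G : mgraph T) : nat :=
  ex_minn (mcolorable_ex G).

Section Collapse.
Variables (V : finType) (F : mgraph V).

(* The vertices of the collapsed graph: those of F that are neither heads nor
   tails, together with h = inr true and t = inr false. The construction is
   total in F; it is the intended contraction when F is collapsible (no two
   heads adjacent, no two tails adjacent) and has a directed edge. A vertex
   that is neither a head nor a tail only meets undirected edges. *)
Definition collapse_vertex : finType :=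
  ({v : V | ~~ is_head F v && ~~ is_tail F v} + bool)%type.

Definition hvertex : collapse_vertex := inr true.
Definition tvertex : collapse_vertex := inr false.

Definition collapse_uedges : {set {set collapse_vertex}} :=
  [set [set (inl p.1 : collapse_vertex); inl p.2]
    | p in [set p : {v : V | ~~ is_head F v && ~~ is_tail F v} *
                    {v : V | ~~ is_head F v && ~~ is_tail F v}
           | uadj F (val p.1) (val p.2)]] :|:
  [set [set (inl w : collapse_vertex); hvertex]
    | w in [set w : {v : V | ~~ is_head F v && ~~ is_tail F v}
           | [exists x, is_head F x && madj F (val w) x]]] :|:
  [set [set (inl w : collapse_vertex); tvertex]
    | w in [set w : {v : V | ~~ is_head F v && ~~ is_tail F v}
           | [exists x, is_tail F x && madj F (val w) x]]].

Lemma collapse_axiom : mgraph_axiom (collapse_uedges, [set (tvertex, hvertex)]).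
Proof.
apply/andP; split; apply/forall_inP => /=.
  move=> e; rewrite !inE => /orP[/orP[]|] /imsetP[p]; rewrite inE => hp ->;
    rewrite cards2 ?eqxx //.
  rewrite (_ : _ != _ = true) //; apply/eqP => -[] p12; move: hp.
  by have := madj_irrefl F (val p.1); rewrite /madj => /norP[/negbTE]; rewrite p12 => ->.
move=> _ /finset.set1P -> /=; rewrite inE !xpair_eqE /=.
apply/negP; rewrite !inE => /orP[/orP[]|] /imsetP[p _] /finset.setP.
- by move/(_ hvertex); rewrite !inE.
- by move/(_ tvertex); rewrite !inE.
- by move/(_ hvertex); rewrite !inE.
Qed.

Definition collapse : mgraph collapse_vertex := MGraph collapse_axiom.

End Collapse.

Record madjmx := MAdjMx {
  msize : nat;
  mU : 'M[nat]_msize;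
  mD : 'M[nat]_msize;
  mU01 : forall i j, mU i j \in [:: 0; 1]%N;
  mU_sym : forall i j, mU i j = mU j i;
  mD02 : forall i j, mD i j \in [:: 0; 2]%N;
  mD_asym : forall i j, mD i j != 0%N -> mD j i = 0%N;
  mUD_excl : forall i j, mU i j = 0%N \/ mD i j = 0%N }.

Definition madjmx_K : madjmx.
Proof.
refine (@MAdjMx 1 (const_mx 1%N) (const_mx 0%N) _ _ _ _ _);
  by move=> i j; rewrite ?mxE //; right.
Defined.

Section Blowup.
Variables (A : madjmx) (x : 'I_(msize A) -> nat).

(* W_i is the fibre over i. Since mD A i i = 0 always, no directed edge lies
   inside a W_i. *)
Definition blowup_vertex : finType := {i : 'I_(msize A) & 'I_(x i)}.

Definition blowup_uedges : {set {set blowup_vertex}} :=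
  [set [set p.1; p.2] | p in [set p : blowup_vertex * blowup_vertex
    | (p.1 != p.2) && (mU A (tag p.1) (tag p.2) == 1%N)]].

Definition blowup_dedges : {set blowup_vertex * blowup_vertex} :=
  [set p | mD A (tag p.1) (tag p.2) == 2%N].

Lemma blowup_axiom : mgraph_axiom (blowup_uedges, blowup_dedges).
Proof.
apply/andP; split; apply/forall_inP => /=.
  by move=> e /imsetP[p]; rewrite inE => /andP[hp _] ->; rewrite cards2 hp.
move=> [u v]; rewrite !inE /= => /eqP uv.
have vu : mD A (tag v) (tag u) = 0%N by apply: mD_asym; rewrite uv.
have U0 : mU A (tag u) (tag v) = 0%N by case: (mUD_excl (tag u) (tag v)) => //; rewrite uv.
have neq : u != v by apply/eqP => E; move: uv vu; rewrite E => ->.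
rewrite neq vu /=; apply/negP => /imsetP[[a b]]; rewrite inE /= => /andP[_ /eqP ab] E.
have : u \in [set a; b] by rewrite -E set21.
have : v \in [set a; b] by rewrite -E set22.
rewrite !inE => /orP[] /eqP hv /orP[] /eqP hu; move: neq U0 ab;
  rewrite hv hu ?eqxx //= => _; last by move=> ->.
by rewrite mU_sym => ->.
Qed.

Definition blowup : mgraph blowup_vertex := MGraph blowup_axiom.

End Blowup.

Definition MF (V : finType) (F : mgraph V) : set madjmx :=
  [set A | A = madjmx_K \/
    [/\ forall t : nat, (0 < t)%N ->
          ~~ mgraph_sub F (blowup (fun _ : 'I_(msize A) => t)),
        (msize A <= (chromatic_number (collapse F)).-1)%N,
        forall i, mU A i i = 0%N,
        mD A <> const_mx 0%N
      & forall i j : 'I_(msize A), i != j ->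
          (0 < mU A i j + mU A j i + mD A i j + mD A j i)%N]]%classic.

Definition is_maximum (R : realType) (S : set R) (m : R) : Prop :=
  S m /\ ubound S m.

(* The maximum of S, or 0 if S has no maximum. *)
Definition maximum (R : realType) (S : set R) : R :=
  xget 0 (is_maximum S).

Section Densities.
Variable R : realType.

Definition ualpha (n : nat) (G : mgraph 'I_n) : R :=
  #|uedges G|%:R / 'C(n, 2)%:R.
Definition dbeta (n : nat) (G : mgraph 'I_n) : R :=
  #|dedges G|%:R / 'C(n, 2)%:R.
Definition weight (rho : R) (n : nat) (G : mgraph 'I_n) : R :=
  #|uedges G|%:R + rho * #|dedges G|%:R.

(* If F has an edge then the edgeless graph is F-free, and all the functions f
   to which this is applied vanish on it; so the default value 0 is harmless. *)
Definition max_free (V : finType) (F : mgraph V) (n : nat)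
    (f : mgraph 'I_n -> R) : R :=
  \big[Num.max/0]_(G : mgraph 'I_n | ~~ mgraph_sub F G) f G.

Definition theta (V : finType) (F : mgraph V) : \bar R :=
  if `[< (fun n => max_free F (@dbeta n)) @ \oo --> (0 : R) >]%classic then +oo%E
  else (maximum [set rho : R |
    limn_esup (fun n =>
      (max_free F (fun G : mgraph 'I_n => ualpha G + rho * dbeta G))%:E)
    <= 1]%E%classic)%:E.

Definition simplex (r : nat) : set 'cV[R]_r :=
  [set y | (forall i, 0 <= y i 0) /\ \sum_i y i 0 = 1]%classic.

Definition weight_mx (rho : R) (A : madjmx) : 'M[R]_(msize A) :=
  map_mx (fun k : nat => k%:R) (mU A) +
  rho *: map_mx (fun k : nat => k%:R) (mD A).

Definition gdensity (rho : R) (A : madjmx) : R :=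
  maximum [set (y^T *m weight_mx rho A *m y) 0 0
          | y in @simplex (msize A)]%classic.

End Densities.

(* Main.v *)
(* Call [F] homomorphic to a matrix [A] if [V(F)] maps to the indices of [A],
   edges going to edges of [A]; this happens iff [F] is contained in some blow-up
   of [A].

   Lower bound: for a point [y] of the simplex, colour [n] vertices independently
   with distribution [y]. The expected density of the pulled back graph is exactly
   the quadratic form of [A] at [y], so an [F]-free graph at least as dense exists
   whenever [F] is not homomorphic to [A]. Applied to an arc with a clique on one
   side, this shows that theta > 1 forces [F] to be collapsible.

   Upper bound: let [G] be [F]-free on [n] vertices and sample [m] of them. Only a
   small fraction of the samples spans a graph to which [F] is homomorphic, because
   a positive fraction would yield a complete box of such samples, hence [F] in
   [G]. So the density of [G] is, up to o(1), at most the Lagrangian of some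
   loopless [A] of size [m] to which [F] is not homomorphic. The Motzkin-Straus
   argument moves the optimal weights to indices that are pairwise adjacent. If
   directed edges remain, there are fewer than chi(collapse F) such indices, since
   a colouring of the collapse of [F] would be a homomorphism; otherwise the value
   is at most 1, the density of [K]. *)

Require Import Defs.
From HB Require Import structures.
From mathcomp Require Import all_boot all_order all_algebra.
From mathcomp Require Import all_classical all_reals all_analysis.
From mathcomp Require Import fingroup perm zify ring lra.
Import Order.TTheory GRing.Theory Num.Theory.
Import numFieldNormedType.Exports.

Set Implicit Arguments.
Unset Strict Implicit.
Unset Printing Implicit Defensive.

Local Open Scope ring_scope.

(** * Counting tools and complete boxes in dense sets of maps *)

Lemma card_sum_mem (T : finType) (A : {set T}) : #|A| = (\sum_x (x \in A))%N.
Proof. by rewrite -sum1_card big_mkcond; apply: eq_bigr => x _; case: ifP. Qed.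

Lemma ffact_upper (n t : nat) : (n ^_ t <= n ^ t)%N.
Proof. by elim: t => // t IH; rewrite ffactnSr expnSr leq_mul ?leq_subr. Qed.

Lemma ffact_lower (n s t : nat) : (t <= s)%N -> ((n - s) ^ t <= n ^_ t)%N.
Proof.
elim: t => // t IH ts; rewrite ffactnSr expnSr leq_mul ?IH ?leq_sub2l //; exact: ltnW.
Qed.

Section Supersaturation.
Local Open Scope nat_scope.
Variables (I T : finType).
Implicit Types (phi psi : {ffun I -> T}) (i : I) (a : T).

Definition ffun_upd phi i a : {ffun I -> T} :=
  [ffun k => if k == i then a else phi k].

(* [(phi, a) |-> (ffun_upd phi i a, phi i)] is an involution. *)
Lemma sum_ffun_upd (S : {set {ffun I -> T}}) i :
  \sum_(phi : {ffun I -> T}) #|[set a | ffun_upd phi i a \in S]| = #|T| * #|S|.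
Proof.
pose sw (p : {ffun I -> T} * T) := (ffun_upd p.1 i p.2, p.1 i).
have swK : involutive sw.
  move=> [phi a]; rewrite /sw /=; congr pair; last by rewrite ffunE eqxx.
  by apply/ffunP => k; rewrite !ffunE; case: eqP => // ->.
transitivity (\sum_(p : {ffun I -> T} * T) ((sw p).1 \in S)).
  rewrite -(pair_bigA _ (fun phi a => (ffun_upd phi i a \in S) : nat)) /=.
  apply: eq_bigr => phi _; rewrite card_sum_mem.
  by apply: eq_bigr => a _; rewrite inE.
rewrite -(reindex_inj (P := xpredT) (F := fun p => (p.1 \in S) : nat) (inv_inj swK)).
rewrite -(pair_bigA _ (fun phi (_ : T) => (phi \in S) : nat)) /=.
rewrite [#|S|]card_sum_mem big_distrr /=.
by apply: eq_bigr => phi _; rewrite sum_nat_const.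
Qed.

(* Double counting of the pairs [(phi, A)] such that every replacement of [phi i]
   by an element of [A] stays in [S]: many [phi] have at least [n / 2q] admissible
   values at [i]. *)
Lemma dense_link (t q : nat) (S : {set {ffun I -> T}}) i :
    0 < q -> 4 * q * t < #|T| -> #|T| ^ #|I| <= q * #|S| ->
  exists2 A : {set T}, #|A| = t &
    #|T| ^ #|I| <= 2 * q * (4 * q) ^ t *
      #|[set phi | [forall a in A, ffun_upd phi i a \in S]]|.
Proof.
move=> q0 nt dS; set n := #|T| in nt dS *; set N := n ^ #|I| in dS *.
pose D phi := [set a | ffun_upd phi i a \in S].
pose S' (A : {set T}) := [set phi | [forall a in A, ffun_upd phi i a \in S]].
have S'E A phi : (phi \in S' A) = (A \subset D phi).
  rewrite inE; apply/forall_inP/fintype.subsetP => H a /H; by rewrite inE.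
have n0 : 0 < n by apply: leq_ltn_trans nt.
have N0 : 0 < N by rewrite expn_gt0 n0.
have dc : \sum_(A : {set T} | #|A| == t) #|S' A| = \sum_phi 'C(#|D phi|, t).
  transitivity (\sum_(A : {set T} | #|A| == t) \sum_phi (A \subset D phi)).
    apply: eq_bigr => A _; rewrite card_sum_mem.
    by apply: eq_bigr => phi _; rewrite S'E.
  rewrite exchange_big; apply: eq_bigr => phi _ /=.
  rewrite -cards_draws card_sum_mem big_mkcond /=.
  by apply: eq_bigr => A _; rewrite inE andbC; case: ifP.
(* The average of [#|D phi|] is at least [n / q]; the [phi] below half of that contribute at most
   half of the total. *)
pose Phi := [set phi | n <= 2 * q * #|D phi|].
have hPhi : N <= 2 * q * #|Phi|.
  have sumD : q * \sum_phi #|D phi| = q * (n * #|S|) by rewrite sum_ffun_upd.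
  have : 2 * (q * \sum_phi #|D phi|) <= 2 * (q * (n * #|Phi|)) + N * n.
    rewrite (bigID (mem Phi)) /= !mulnDr leq_add //.
      rewrite !leq_pmul2l // -[#|Phi|]sum1_card big_distrr /= leq_sum // => phi _.
      by rewrite muln1 max_card.
    rewrite mulnA big_distrr /=.
    apply: (@leq_trans (\sum_(phi | phi \notin Phi) n)).
      by apply: leq_sum => phi; rewrite inE -ltnNge => /ltnW.
    by rewrite sum_nat_const leq_mul2r /N /n -card_ffun max_card orbT.
  rewrite sumD => h.
  have : n * (2 * N) <= n * (2 * q * #|Phi| + N) by nia.
  by rewrite leq_pmul2l //; lia.
have big : N * n ^ t <= 2 * q * (4 * q) ^ t * (t`! * \sum_(A : {set T} | #|A| == t) #|S' A|).
  rewrite dc -mulnA; apply: (leq_trans (leq_mul hPhi (leqnn _))); rewrite -!mulnA.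
  rewrite !leq_pmul2l // -[#|Phi|]sum1_card big_distrl /= [X in _ <= _ * (_ * X)](bigID (mem Phi)) /= !mulnDr.
  apply: leq_trans (leq_addr _ _); rewrite !big_distrr /=; apply: leq_sum => phi.
  rewrite inE mul1n => hphi; rewrite [t`! * _]mulnC bin_ffact.
  (* From [n <= 2q #|D phi|] and [4qt < n] follows [n <= 4q (#|D phi| - t)], which bounds the
     falling factorial from below. *)
  apply: (@leq_trans ((4 * q) ^ t * (#|D phi| - t) ^ t)).
    rewrite -expnMn; have [->|t0] := posnP t; first by rewrite !expn0.
    by rewrite leq_exp2r //; nia.
  by rewrite leq_mul2l ffact_lower ?orbT.
have [/existsP[A /andP[/eqP At hA]]|] :=
  boolP [exists A : {set T}, (#|A| == t) && (N <= 2 * q * (4 * q) ^ t * #|S' A|)].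
  by exists A.
rewrite negb_exists => /forallP none; exfalso.
have tn : t <= n by nia.
suff : N * n ^ t < N * n ^ t by rewrite ltnn.
apply: (leq_ltn_trans big); rewrite mulnCA big_distrr /=.
apply: (@leq_ltn_trans (t`! * \sum_(A : {set T} | #|A| == t) N.-1)).
  rewrite leq_mul2l; apply/orP; right; apply: leq_sum => A At.
  by have := none A; rewrite At /= -ltnNge; lia.
rewrite (_ : \sum_(_ | _) _ = 'C(n, t) * N.-1); last first.
  rewrite -card_draws -sum1dep_card big_distrl /=.
  by apply: eq_bigr => A _; rewrite mul1n.
rewrite mulnA [t`! * _]mulnC bin_ffact.
apply: (@leq_ltn_trans (n ^ t * N.-1)).
  by rewrite leq_mul2r ffact_upper orbT.
by rewrite mulnC ltn_pmul2r ?expn_gt0 ?n0 // prednK.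
Qed.

End Supersaturation.

(* Erdos' theorem on complete multipartite subhypergraphs, blowing up one
   coordinate at a time. *)
Lemma dense_box (I : finType) (t q : nat) : (0 < q)%N ->
  exists n0 : nat, forall (T : finType) (S : {set {ffun I -> T}}),
    (n0 <= #|T|)%N -> (#|T| ^ #|I| <= q * #|S|)%N ->
  exists2 A : I -> {set T}, (forall i, #|A i| = t) &
    forall phi : {ffun I -> T}, (forall i, phi i \in A i) -> phi \in S.
Proof.
move=> q0.
(* Induction over a list of coordinates: those listed range over sets of size [t], the others are
   frozen at the values of [psi]. *)
suff : exists n0 : nat, forall (T : finType) (S : {set {ffun I -> T}}),
    (n0 <= #|T|)%N -> (#|T| ^ #|I| <= q * #|S|)%N ->
  exists (A : I -> {set T}) (psi : {ffun I -> T}), (forall i, i \in enum I -> #|A i| = t) /\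
    forall phi : {ffun I -> T},
      (forall i, if i \in enum I then phi i \in A i else phi i == psi i) -> phi \in S.
  move=> [n0 H]; exists n0 => T S hT hS; have [A [psi [At hA]]] := H T S hT hS.
  exists A => [i|phi hphi]; first by rewrite At ?mem_enum.
  by apply: hA => i; rewrite mem_enum; exact: hphi.
elim: (enum I) (enum_uniq I) q q0 => [_ q q0|i s IH /= /andP[is_ us] q q0].
  exists 1%N => T S hT hS.
  have /card_gt0P[psi psiS] : (0 < #|S|)%N.
    by rewrite lt0n; apply: contraTneq hS => ->; rewrite muln0 -ltnNge expn_gt0 hT.
  exists (fun=> finset.set0), psi; split => // phi hphi.
  by rewrite (_ : phi = psi) //; apply/ffunP => i; apply/eqP/hphi.
have q'0 : (0 < 2 * q * (4 * q) ^ t)%N.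
  by rewrite !muln_gt0 expn_gt0 muln_gt0 q0.
have [n0 H] := IH us _ q'0.
exists (maxn n0 (4 * q * t).+1) => T S; rewrite geq_max => /andP[hT hT'] hS.
have [B Bt dS'] := dense_link i q0 hT' hS.
have [A [psi [At hA]]] := H T _ hT dS'.
exists (fun j => if j == i then B else A j), psi; split.
  move=> j; rewrite inE; case: eqP => //= _; exact: At.
move=> phi hphi.
(* Resetting coordinate [i] to its frozen value puts [phi] in the box found inside the link;
   restoring [phi i], an element of [B], then lands in [S]. *)
have : ffun_upd phi i (psi i) \in [set phi | [forall a in B, ffun_upd phi i a \in S]].
  apply: hA => j; rewrite !ffunE; have := hphi j; rewrite inE.
  by case: eqP => [-> _|//]; rewrite (negbTE is_).
rewrite inE => /forall_inP/(_ (phi i)); have := hphi i; rewrite inE eqxx /= => -> /(_ isT).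
rewrite (_ : ffun_upd _ _ _ = phi) //.
by apply/ffunP => k; rewrite !ffunE; case: eqP => // ->.
Qed.

(** * Homomorphisms and embeddings of mixed graphs *)

Section Homomorphisms.
Variables (V : finType) (F : mgraph V).

(* Vertices of [F] may be identified; [u] may have loops, so that undirected
   edges of [F] can be contracted onto a looped vertex. *)
Definition mhom (T : finType) (u d : rel T) : bool :=
  [exists c : {ffun V -> T},
    [forall x, forall y, uadj F x y ==> [|| u (c x) (c y), d (c x) (c y) | d (c y) (c x)]] &&
    [forall x, forall y, dadj F x y ==> d (c x) (c y)]].

Lemma mhomP (T : finType) (u d : rel T) :
  reflect (exists2 c : V -> T,
      forall x y, uadj F x y -> [|| u (c x) (c y), d (c x) (c y) | d (c y) (c x)] &
      forall x y, dadj F x y -> d (c x) (c y))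
    (mhom u d).
Proof.
apply: (iffP existsP) => [[c /andP[/forallP hu /forallP hd]]|[c hu hd]].
  by exists c => x y; [apply/implyP/(forallP (hu x)) | apply/implyP/(forallP (hd x))].
exists [ffun x => c x]; apply/andP; split; apply/forallP => x; apply/forallP => y;
  apply/implyP; rewrite !ffunE; [exact: hu | exact: hd].
Qed.

Lemma mhom_comp (T W : finType) (u d : rel T) (u' d' : rel W) (f : T -> W) :
    (forall x y, u x y -> [|| u' (f x) (f y), d' (f x) (f y) | d' (f y) (f x)]) ->
    (forall x y, d x y -> d' (f x) (f y)) -> mhom u d -> mhom u' d'.
Proof.
move=> hu hd /mhomP[c cu cd]; apply/mhomP; exists (f \o c) => x y /=; last by move/cd/hd.
by move=> /cu /or3P[/hu //|/hd ->|/hd ->]; rewrite ?orbT.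
Qed.

Lemma mgraph_subP (W : finType) (G : mgraph W) :
  reflect (exists f : V -> W, [/\ injective f,
      forall x y, uadj F x y -> madj G (f x) (f y) &
      forall x y, dadj F x y -> dadj G (f x) (f y)])
    (mgraph_sub F G).
Proof.
apply: (iffP existsP) => [[f /and3P[/injectiveP fi /forallP hu /forallP hd]]|[f [fi hu hd]]].
  by exists f; split=> // x y; apply/implyP; [apply: (forallP (hu x)) | apply: (forallP (hd x))].
exists [ffun x => f x]; apply/and3P; split.
- by apply/injectiveP => x y; rewrite !ffunE => /fi.
- by apply/forallP => x; apply/forallP => y; apply/implyP; rewrite !ffunE; exact: hu.
- by apply/forallP => x; apply/forallP => y; apply/implyP; rewrite !ffunE; exact: hd.
Qed.

Lemma mgraph_sub_mhom (W : finType) (G : mgraph W) :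
  mgraph_sub F G -> mhom (uadj G) (dadj G).
Proof. by case/mgraph_subP => f [_ hu hd]; apply/mhomP; exists f. Qed.

End Homomorphisms.

(** * Mixed graphs and their adjacency relations *)

Section MixedGraphs.
Variables (T : finType) (G : mgraph T).

Lemma uadj_sym : symmetric (uadj G).
Proof. by move=> x y; rewrite /uadj finset.setUC. Qed.

Lemma uadj_irrefl : irreflexive (uadj G).
Proof. by move=> x; have := madj_irrefl G x; rewrite /madj => /norP[/negbTE]. Qed.

Lemma dadjP x y : dadj G x y -> [/\ x != y, ~~ dadj G y x & ~~ uadj G x y].
Proof.
by case/andP: (mgraph_valP G) => _ /forall_inP hD /hD /and3P[].
Qed.

Lemma madj_sym : symmetric (madj G).
Proof. by move=> x y; rewrite /madj uadj_sym [dadj G x y || _]orbC. Qed.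

Lemma card_uedges : (2 * #|uedges G| = \sum_x \sum_y uadj G x y)%N.
Proof.
rewrite pair_bigA /= mulnC -sum_nat_const.
rewrite (eq_bigr (fun e : {set T} => \sum_(p : T * T | [set p.1; p.2] == e) 1)%N).
  rewrite (exchange_big_dep xpredT) //=; apply: eq_bigr => -[x y] _ /=.
  rewrite (eq_bigl (fun e => (e == [set x; y]) && (e \in uedges G))) => [|e].
    by rewrite big_mkcondr /= big_pred1_eq /uadj; case: ifP.
  by rewrite andbC eq_sym.
case/andP: (mgraph_valP G) => /forall_inP hU _ e /hU /cards2P[a [b [ab ->]]].
rewrite sum1dep_card (_ : [set _ | _] = [set (a, b); (b, a)]).
  by rewrite cards2 xpair_eqE (negbTE ab).
apply/setP => -[x y]; rewrite !inE !xpair_eqE /=.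
apply/eqP/orP => [E|[/andP[/eqP-> /eqP->]|/andP[/eqP-> /eqP->]] //]; last by rewrite finset.setUC.
have : x \in [set a; b] by rewrite -E set21.
have : y \in [set a; b] by rewrite -E set22.
have : a \in [set x; y] by rewrite E set21.
have : b \in [set x; y] by rewrite E set22.
rewrite !inE => /pred2P hb /pred2P ha /pred2P hy /pred2P hx.
by case: hx hy ha hb => -> [] -> ha hb; [|left|right|]; rewrite ?eqxx //;
  case/eqP: ab; case: ha; case: hb.
Qed.

Lemma card_dedges : (#|dedges G| = \sum_x \sum_y dadj G x y)%N.
Proof.
rewrite pair_bigA /= -sum1_card big_mkcond; apply: eq_bigr => -[x y] _ /=.
by rewrite /dadj; case: ifP.
Qed.

End MixedGraphs.

Section RelationGraph.
Variables (T : finType) (u d : rel T).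
Hypotheses (u_sym : symmetric u) (d_asym : forall x y, d x y -> ~~ d y x)
  (ud_excl : forall x y, d x y -> ~~ u x y).

(** Loops of [u] are dropped here: pulling back a looped index makes its class a clique, not a set
    of looped vertices. *)
Definition rel_graph_val : {set {set T}} * {set T * T} :=
  ([set [set p.1; p.2] | p in [set p : T * T | (p.1 != p.2) && u p.1 p.2]],
   [set p : T * T | d p.1 p.2]).

Lemma rel_graph_uadj x y : ([set x; y] \in rel_graph_val.1) = (x != y) && u x y.
Proof.
apply/imsetP/idP => [[[a b]]|xy]; last by exists (x, y); rewrite ?inE.
rewrite inE /= => /andP[ab uab] E.
have : x \in [set a; b] by rewrite -E set21.
have : y \in [set a; b] by rewrite -E set22.
have : a \in [set x; y] by rewrite E set21.
have : b \in [set x; y] by rewrite E set22.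
rewrite !inE; case: (eqVneq x y) => [->|xy].
  by rewrite !orbb => /eqP ea /eqP eb; move: ab; rewrite ea eb eqxx.
by move=> _ _ /orP[]/eqP ey /orP[]/eqP ex; move: xy; rewrite ex ey ?eqxx //= u_sym.
Qed.

Lemma rel_graph_axiom : mgraph_axiom rel_graph_val.
Proof.
apply/andP; split; apply/forall_inP.
  by move=> e /imsetP[p]; rewrite inE => /andP[hp _] ->; rewrite cards2 hp.
move=> [x y]; rewrite rel_graph_uadj !inE /= => xy.
rewrite (d_asym xy) negb_and (ud_excl xy) orbT !andbT.
by apply: contraTneq xy => ->; apply/negP => /[dup] /d_asym /negP.
Qed.

Definition rel_graph : mgraph T := MGraph rel_graph_axiom.

Lemma uadj_rel_graph x y : uadj rel_graph x y = (x != y) && u x y.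
Proof. exact: rel_graph_uadj. Qed.

Lemma dadj_rel_graph x y : dadj rel_graph x y = d x y.
Proof. by rewrite /dadj inE. Qed.

End RelationGraph.

(** * Edge weights and the quadratic form of a matrix *)

Section Weights.
Variables (R : realType) (rho : R).

(** A double sum over ordered pairs meets an undirected edge twice but a directed edge once; the
    factor 2 compensates and agrees with the entries 2 of [mD]. *)
Definition wt (T : finType) (u d : rel T) (x y : T) : R :=
  (u x y)%:R + rho * (2 * (d x y)%:R).

Lemma weight_sum n (G : mgraph 'I_n) :
  2 * weight rho G = \sum_x \sum_y wt (uadj G) (dadj G) x y.
Proof.
rewrite /weight mulrDr -natrM card_uedges card_dedges natr_sum.
rewrite natr_sum [2 * _]mulrCA [2 * _]mulr_sumr mulr_sumr -big_split /=.
apply: eq_bigr => x _; rewrite !natr_sum !mulr_sumr -big_split /=.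
by apply: eq_bigr.
Qed.

End Weights.

Definition mx_urel (A : madjmx) : rel 'I_(msize A) := fun i j => mU A i j == 1%N.
Definition mx_drel (A : madjmx) : rel 'I_(msize A) := fun i j => mD A i j == 2%N.

Section MatrixRelations.
Variable A : madjmx.

Lemma mx_urel_val i j : mU A i j = mx_urel i j :> nat.
Proof. by have := mU01 (m := A) i j; rewrite /mx_urel !inE => /orP[]/eqP->. Qed.

Lemma mx_drel_val i j : mD A i j = (2 * mx_drel i j)%N.
Proof. by have := mD02 (m := A) i j; rewrite /mx_drel !inE => /orP[]/eqP->. Qed.

Lemma mx_urel_sym : symmetric (@mx_urel A).
Proof. by move=> i j; rewrite /mx_urel (mU_sym (m := A) i j). Qed.

Lemma mx_drel_asym i j : mx_drel i j -> ~~ @mx_drel A j i.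
Proof. by rewrite /mx_drel => /eqP h; rewrite (mD_asym (m := A) (i := i) (j := j)) ?h. Qed.

Lemma mx_excl i j : mx_drel i j -> ~~ @mx_urel A i j.
Proof. by rewrite /mx_drel /mx_urel => /eqP h; case: (mUD_excl (m := A) i j) => [->|] //; rewrite h. Qed.

Lemma quad_form (R : realType) (rho : R) (y : 'cV[R]_(msize A)) :
  (y^T *m weight_mx rho A *m y) 0 0 =
  \sum_i \sum_j y i 0 * y j 0 * wt rho (@mx_urel A) (@mx_drel A) i j.
Proof.
rewrite mxE exchange_big; apply: eq_bigr => j _ /=.
rewrite mxE big_distrl; apply: eq_bigr => i _ /=.
rewrite !mxE /wt mx_urel_val mx_drel_val natrM; ring.
Qed.

Lemma blowup_mhom (V : finType) (F : mgraph V) (x : 'I_(msize A) -> nat) :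
  mgraph_sub F (blowup x) -> mhom F (@mx_urel A) (@mx_drel A).
Proof.
move/mgraph_sub_mhom; apply: (mhom_comp (f := @tag _ _)) => a b; rewrite /dadj /uadj.
  move=> /imsetP[[p q]]; rewrite inE /= => /andP[pq upq] E.
  have : a \in [set p; q] by rewrite -E set21.
  have : b \in [set p; q] by rewrite -E set22.
  have : p \in [set a; b] by rewrite E set21.
  have : q \in [set a; b] by rewrite E set22.
  rewrite !inE; case: (eqVneq a b) => [->|ab].
    by rewrite !orbb => /eqP ep /eqP eq; move: pq; rewrite ep eq eqxx.
  by move=> _ _ /orP[]/eqP ey /orP[]/eqP ex; move: ab; rewrite ex ey ?eqxx //= /mx_urel ?[mU A (tag q) _]mU_sym upq.
by rewrite inE.
Qed.

(** Classes of size [#|V|] leave room for each vertex to use its own rank as position, so vertices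
    with a common image index stay distinct. *)
Lemma mhom_blowup (V : finType) (F : mgraph V) :
  mhom F (@mx_urel A) (@mx_drel A) ->
  mgraph_sub F (blowup (fun _ : 'I_(msize A) => #|V|)).
Proof.
case/mhomP => c cu cd; apply/mgraph_subP.
pose f v : blowup_vertex (fun _ : 'I_(msize A) => #|V|) :=
  Tagged (fun=> 'I_#|V|) (enum_rank v) (i := c v).
have fi : injective f.
  move=> a b E; apply: enum_rank_inj; apply/val_inj.
  exact: (congr1 (fun z : {i : 'I_(msize A) & 'I_#|V|} => nat_of_ord (tagged z)) E).
exists f; split=> // a b ab; last by have := cd _ _ ab; rewrite /dadj inE.
have nab : f a != f b.
  by rewrite (inj_eq fi); apply: contraTneq ab => ->; rewrite uadj_irrefl.
rewrite /madj; case/or3P: (cu _ _ ab) => h; apply/or3P.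
- by constructor 1; apply/imsetP; exists (f a, f b); rewrite // inE nab.
- by constructor 2; rewrite /dadj inE.
- by constructor 3; rewrite /dadj inE.
Qed.

End MatrixRelations.

(** * Sampling with independent coordinates *)

Section Sampling.
Variables (R : realType) (I T : finType) (p : T -> R).
Hypothesis p1 : \sum_a p a = 1.

Lemma sum_prod_ffun : \sum_(phi : {ffun I -> T}) \prod_i p (phi i) = 1.
Proof. by rewrite -(bigA_distr_bigA (fun=> p)) big1. Qed.

(** Two distinct coordinates of an independent sample have the product law. By linearity it is
    enough to treat the indicator of one pair of values. *)
Lemma sample_pair (h : T -> T -> R) (i j : I) : i != j ->
  \sum_(phi : {ffun I -> T}) (\prod_k p (phi k)) * h (phi i) (phi j) =
  \sum_a \sum_b p a * p b * h a b.
Proof.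
move=> ij; have ji : j != i by rewrite eq_sym.
have point a b : \sum_(phi : {ffun I -> T})
    (\prod_k p (phi k)) * ((phi i == a)%:R * (phi j == b)%:R) = p a * p b.
  (* Absorbing the indicators into the factors lets the sum over all maps split as a product of
     sums, each equal to 1 except at [i] and [j]. *)
  pose F k c := p c * (if k == i then (c == a)%:R else if k == j then (c == b)%:R else 1).
  rewrite (eq_bigr (fun phi : {ffun I -> T} => \prod_k F k (phi k))) => [|phi _].
    rewrite -(bigA_distr_bigA F) (bigD1 i) //= (bigD1 j) //= [X in _ * (_ * X)]big1 => [|k /andP[ki kj]].
      rewrite mulr1; congr (_ * _); rewrite /F eqxx ?(negbTE ji).
        by rewrite (bigD1 a) //= eqxx mulr1 big1 ?addr0 // => c /negbTE->; rewrite mulr0.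
      by rewrite (bigD1 b) //= eqxx mulr1 big1 ?addr0 // => c /negbTE->; rewrite mulr0.
    rewrite -[RHS]p1; apply: eq_bigr => c _.
    by rewrite /F (negbTE ki) (negbTE kj) mulr1.
  rewrite big_split /=; congr (_ * _).
  rewrite (bigD1 i) //= (bigD1 j) //= eqxx (negbTE ji) eqxx big1 ?mulr1 //.
  by move=> k /andP[/negbTE ki /negbTE kj]; rewrite ki kj.
under [RHS]eq_bigr do under eq_bigr do rewrite -point mulr_suml.
under [RHS]eq_bigr do rewrite exchange_big.
rewrite [RHS]exchange_big; apply: eq_bigr => phi _ /=.
rewrite (bigD1 (phi i)) //= [X in _ + X]big1 => [|a /negbTE ai].
  rewrite addr0 (bigD1 (phi j)) //= !eqxx [X in _ + X]big1 ?addr0 ?mulr1 // => b /negbTE bj.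
  by rewrite [phi j == b]eq_sym bj !(mulr0, mul0r).
by apply: big1 => b _; rewrite [phi i == a]eq_sym ai !(mulr0, mul0r).
Qed.

Lemma sample_sum (h : T -> T -> R) :
  \sum_(phi : {ffun I -> T}) (\prod_k p (phi k)) *
    (\sum_i \sum_(j | j != i) h (phi i) (phi j)) =
  #|I|%:R * (#|I|%:R - 1) * \sum_a \sum_b p a * p b * h a b.
Proof.
under eq_bigr do rewrite mulr_sumr.
rewrite exchange_big /= -mulrA mulr_natl -sumr_const; apply: eq_bigr => i _.
under eq_bigr do rewrite mulr_sumr.
rewrite exchange_big /= (eq_bigr (fun=> \sum_a \sum_b p a * p b * h a b)) => [|j ji]; last first.
  by rewrite sample_pair // eq_sym.
have I0 : (0 < #|I|)%N by apply/card_gt0P; exists i.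
by rewrite sumr_const -(@natrB _ _ 1) // mulr_natl subn1 (cardC1 i).
Qed.

Hypothesis p0 : forall a, 0 <= p a.

(** Some sample reaches the mean: otherwise the gaps are positive while their weighted sum is 0, so
    every weight vanishes although the weights sum to 1. *)
Lemma sample_exists (h : T -> T -> R) : exists phi : {ffun I -> T},
  #|I|%:R * (#|I|%:R - 1) * (\sum_a \sum_b p a * p b * h a b) <=
  \sum_i \sum_(j | j != i) h (phi i) (phi j).
Proof.
apply/existsP; apply: contraPT sum_prod_ffun; rewrite negb_exists => /forallP none.
set M := _ * _ in none *.
have P0 (phi : {ffun I -> T}) : 0 <= \prod_k p (phi k) by apply: prodr_ge0.
have E : \sum_(phi : {ffun I -> T}) (\prod_k p (phi k)) *
    (M - \sum_i \sum_(j | j != i) h (phi i) (phi j)) = 0.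
  under eq_bigr do rewrite mulrBr.
  by rewrite sumrB sample_sum -mulr_suml sum_prod_ffun mul1r subrr.
have pos (phi : {ffun I -> T}) :
    0 < M - \sum_i \sum_(j | j != i) h (phi i) (phi j).
  by rewrite subr_gt0 ltNge none.
have /psumr_eq0P z : forall phi : {ffun I -> T}, true ->
    0 <= (\prod_k p (phi k)) * (M - \sum_i \sum_(j | j != i) h (phi i) (phi j)).
  by move=> phi _; rewrite mulr_ge0 // ltW.
rewrite big1 => [|phi _]; first by move/eqP; rewrite eq_sym oner_eq0.
by apply/eqP; have /eqP := z E phi isT; rewrite mulf_eq0 (gt_eqF (pos phi)) orbF.
Qed.

End Sampling.

Lemma natr_bin2 (R : realType) (n : nat) : (0 < n)%N ->
  n%:R * (n%:R - 1) = 2 * 'C(n, 2)%:R :> R.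
Proof.
move=> n0; rewrite -(@natrB _ _ 1) // -!natrM mulnC (mulnC 2) -[2%N]/(2`!).
by rewrite bin_ffact ffactnSr ffactn1 mulnC.
Qed.

(** * Lower bound from random pullbacks *)

Section LowerBound.
Variables (R : realType) (rho : R) (V : finType) (F : mgraph V).

(** There is no error term: only pairs of distinct vertices are counted, and these may share a
    colour, so loops of [A] contribute in full. *)
Lemma max_free_lower (A : madjmx) (y : 'cV[R]_(msize A)) (n : nat) :
    (1 < n)%N -> simplex y -> ~~ mhom F (@mx_urel A) (@mx_drel A) ->
  (y^T *m weight_mx rho A *m y) 0 0 <=
  max_free F (fun G : mgraph 'I_n => weight rho G / 'C(n, 2)%:R).
Proof.
move=> n1 [y0 y1] nF.
have [phi hphi] := sample_exists 'I_n y1 y0 (wt rho (@mx_urel A) (@mx_drel A)).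
pose u : rel 'I_n := fun i j => mx_urel (phi i) (phi j).
pose d : rel 'I_n := fun i j => mx_drel (phi i) (phi j).
have us : symmetric u by move=> i j; exact: mx_urel_sym.
have da i j : d i j -> ~~ d j i by exact: mx_drel_asym.
have ud i j : d i j -> ~~ u i j by exact: mx_excl.
pose G := rel_graph us da ud.
have GF : ~~ mgraph_sub F G.
  apply: contra nF => /mgraph_sub_mhom; apply: (mhom_comp (f := phi)) => i j.
    by rewrite uadj_rel_graph /u => /andP[_ ->].
  by rewrite dadj_rel_graph.
have c0 : 0 < 'C(n, 2)%:R :> R by rewrite ltr0n bin_gt0.
have cE := natr_bin2 R (ltnW n1).
rewrite /max_free; apply: le_trans (le_bigmax_cond 0 (fun H : mgraph 'I_n => weight rho H / 'C(n, 2)%:R) GF).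
rewrite quad_form ler_pdivlMr // mulrC -(ler_pM2l (x := 2)) // mulrA -cE weight_sum.
rewrite -[n in n%:R * _]card_ord -[n in n%:R - 1]card_ord; apply: le_trans hphi _.
rewrite le_eqVlt; apply/orP; left; apply/eqP; apply: eq_bigr => i _.
(* The two double sums differ only by the diagonal, which vanishes in [G]. *)
rewrite [RHS](bigD1 i) //= [X in X + _](_ : _ = 0) ?add0r.
  by apply: eq_bigr => j ji; rewrite /wt uadj_rel_graph dadj_rel_graph eq_sym ji.
rewrite /wt uadj_rel_graph eqxx dadj_rel_graph add0r.
by case: (boolP (d i i)) => [/[dup] /da /negP//|_]; rewrite !mulr0.
Qed.

End LowerBound.

Section MatrixOfRelations.
Variables (r : nat) (u d : rel 'I_r).
Hypotheses (u_sym : symmetric u) (d_asym : forall i j, d i j -> ~~ d j i)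
  (ud_excl : forall i j, d i j -> ~~ u i j).

Definition rel_mx : madjmx.
Proof.
refine (@MAdjMx r (\matrix_(i, j) nat_of_bool (u i j))
  (\matrix_(i, j) (2 * nat_of_bool (d i j))%N) _ _ _ _ _).
- by move=> i j; rewrite mxE; case: (u i j).
- by move=> i j; rewrite !mxE u_sym.
- by move=> i j; rewrite mxE; case: (d i j).
- by move=> i j; rewrite !mxE; case: (boolP (d i j)) => // /d_asym /negbTE ->.
- move=> i j; rewrite !mxE; case: (boolP (d i j)) => [/ud_excl /negbTE ->|_]; by [left|right].
Defined.

Lemma rel_mx_urel : @mx_urel rel_mx = u.
Proof. by apply/funext => i; apply/funext => j; rewrite /mx_urel mxE eqb1. Qed.

Lemma rel_mx_drel : @mx_drel rel_mx = d.
Proof. by apply/funext => i; apply/funext => j; rewrite /mx_drel mxE; case: (d i j). Qed.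

End MatrixOfRelations.

Lemma limn_esup_ge (R : realType) (u : nat -> R) (c : R) (N : nat) :
  (forall n, (N <= n)%N -> c <= u n) -> (c%:E <= limn_esup (fun n => (u n)%:E))%E.
Proof.
move=> cu; apply: le_ereal_inf_tmp => _ [A [M _ MA] <-].
apply: le_trans (ereal_sup_ubound _); last by exists (maxn M N) => //; apply: MA; exact: leq_maxl.
by rewrite lee_fin cu // leq_maxr.
Qed.

Lemma limn_esup_le (R : realType) (u : nat -> R) (c : R) (N : nat) :
  (forall n, (N <= n)%N -> u n <= c) -> (limn_esup (fun n => (u n)%:E) <= c%:E)%E.
Proof.
move=> uc; apply: le_trans (ereal_inf_lbound _) _.
  by exists [set n | (N <= n)%N]%classic; [exists N|reflexivity].
by apply: ge_ereal_sup => _ [n Nn <-]; rewrite lee_fin uc.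
Qed.

(** * Collapsibility and colourings of the collapse *)

Section Collapsible.
Variables (V : finType) (F : mgraph V).

Definition collapsible : Prop :=
  (forall x y, is_head F x -> is_head F y -> ~~ madj F x y) /\
  (forall x y, is_tail F x -> is_tail F y -> ~~ madj F x y).

Section FromTheta.
Variable R : realType.

(* Index [0] points to index [1], and one of the two classes is a clique. *)
Definition arc_loop_urel (k : 'I_2) : rel 'I_2 := fun i j => (i == k) && (j == k).
Definition arc_drel : rel 'I_2 := fun i j => (i == 0) && (j == 1).

Definition arc_loop_mx (k : 'I_2) : madjmx.
Proof.
refine (@rel_mx 2 (arc_loop_urel k) arc_drel _ _ _).
- by move=> i j; rewrite /arc_loop_urel andbC.
- by move=> i j /andP[/eqP-> /eqP->].
- move=> i j /andP[/eqP-> /eqP->]; rewrite /arc_loop_urel.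
  by apply/andP => -[/eqP <-].
Defined.

Lemma arc_loop_max_free (k : 'I_2) (rho : R) : 1 < rho ->
    ~~ mhom F (arc_loop_urel k) arc_drel ->
  exists2 c : R, 1 < c & forall n, (1 < n)%N ->
    c <= max_free F (fun G : mgraph 'I_n => weight rho G / 'C(n, 2)%:R).
Proof.
(* With weight [x] on the loopless index the form is [(1 - x)^2 + 2 rho x (1 - x)]. This [x]
   maximises it, with value [1 + x (rho - 1)]. *)
move=> rho1 nF; pose x := (rho - 1) / (2 * rho - 1).
have d0 : 0 < 2 * rho - 1 by lra.
have x0 : 0 < x by rewrite divr_gt0 // subr_gt0.
have x1 : x < 1 by rewrite ltr_pdivrMr //; lra.
exists ((1 - x) ^+ 2 + 2 * rho * (x * (1 - x))).
  have -> : (1 - x) ^+ 2 + 2 * rho * (x * (1 - x)) = 1 + x * (rho - 1).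
    have : x * (2 * rho - 1) = rho - 1 by rewrite divfK // gt_eqF.
    move=> xd; transitivity (1 + 2 * x * (rho - 1) - x * (x * (2 * rho - 1))); first by ring.
    by rewrite xd; ring.
  by rewrite ltrDl mulr_gt0 // subr_gt0.
move=> n n1.
pose y : 'cV[R]_(msize (arc_loop_mx k)) := \col_(i < 2) (if i == k then 1 - x else x).
have -> : (1 - x) ^+ 2 + 2 * rho * (x * (1 - x)) =
    (y^T *m weight_mx rho (arc_loop_mx k) *m y) 0 0.
  rewrite quad_form rel_mx_urel rel_mx_drel /wt !big_ord_recl !big_ord0 !mxE.
  rewrite /arc_loop_urel /arc_drel.
  by case: k {nF y} => -[|[|//]] ? /=; rewrite !mulr0 !mulr1 !addr0 !add0r; ring.
apply: max_free_lower => //; last by rewrite rel_mx_urel rel_mx_drel.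
split=> [i|]; first by rewrite mxE; case: ifP => _; lra.
rewrite !big_ord_recl big_ord0 !mxE addr0.
by case: k {nF y} => -[|[|//]] ? /=; ring.
Qed.

Lemma theta_collapsible : (1 < theta R F < +oo)%E -> collapsible.
Proof.
rewrite /theta; case: asboolP => [_ /andP[_]|_]; first by rewrite ltxx.
(* The fallback value 0 of [maximum] contradicts [1 < theta], so the maximum defining theta is
   attained. *)
rewrite lte_fin /maximum; case: xgetP => [rho _ [Srho _]|_] /andP[rho1 _]; last first.
  by move: rho1; rewrite ltr10.
have nohom k : mhom F (arc_loop_urel k) arc_drel.
  apply: contraT => /(arc_loop_max_free rho1)[c c1 hc].
  have : (c%:E <= 1%:E)%E.
    apply: le_trans Srho; apply: (limn_esup_ge (N := 2)) => n n2.
    apply: le_trans (hc n n2) _; rewrite le_eqVlt; apply/orP; left; apply/eqP.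
    by apply: eq_bigr => G _; rewrite /weight /ualpha /dbeta mulrDl mulrA.
  by rewrite lee_fin leNgt c1.
(* The index [k'] carries no loop, so its fibre under [c] spans no edge. *)
have key (k k' : 'I_2) : k' != k ->
    forall c : V -> 'I_2,
    (forall x y, uadj F x y ->
      [|| arc_loop_urel k (c x) (c y), arc_drel (c x) (c y) | arc_drel (c y) (c x)]) ->
    (forall x y, dadj F x y -> arc_drel (c x) (c y)) ->
    forall x y, c x = k' -> c y = k' -> ~~ madj F x y.
  move=> /negbTE kk c cu cd x y cx cy.
  have nd : arc_drel k' k' = false by apply/andP => -[/eqP->].
  by apply/or3P => -[/cu|/cd|/cd]; rewrite cx cy ?nd // /arc_loop_urel kk.
(* A clique on the tail side leaves the heads independent; a clique on the head side does the same
   for the tails. *)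
split=> x y /existsP[a ax] /existsP[b yb].
  have /mhomP[c cu cd] := nohom 0; apply: (key 0 1 _ c) => //.
    by have /andP[_ /eqP] := cd _ _ ax.
  by have /andP[_ /eqP] := cd _ _ yb.
have /mhomP[c cu cd] := nohom 1; apply: (key 1 0 _ c) => //.
  by have /andP[/eqP] := cd _ _ ax.
by have /andP[/eqP] := cd _ _ yb.
Qed.

End FromTheta.

Hypothesis coll : collapsible.

Definition collapse_map (v : V) : collapse_vertex F :=
  if insub v is Some w then inl w else inr (is_head F v).

(** An arc into a vertex that is also a tail would join two tails. *)
Lemma head_not_tail v : is_head F v -> ~~ is_tail F v.
Proof.
move=> /existsP[u uv]; apply/negP => tv.
have tu : is_tail F u by apply/existsP; exists v.
by have := coll.2 _ _ tu tv; rewrite /madj uv orbT.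
Qed.

Lemma collapse_map_head v : is_head F v -> collapse_map v = hvertex F.
Proof. by move=> hv; rewrite /collapse_map insubF ?hv. Qed.

Lemma collapse_map_tail v : is_tail F v -> collapse_map v = tvertex F.
Proof.
move=> tv; rewrite /collapse_map insubF ?tv ?andbF //; congr inr.
by apply/negbTE; apply: contraTN tv; exact: head_not_tail.
Qed.

Lemma collapse_th : madj (collapse F) (tvertex F) (hvertex F).
Proof. by rewrite /madj /dadj /dedges /= inE eqxx orbT. Qed.

(** Only two heads or two tails are identified, and collapsibility makes such pairs nonadjacent. A
    head adjacent to a tail, even by an undirected edge, goes to the arc from t to h. *)
Lemma collapse_map_adj x y :
  madj F x y -> madj (collapse F) (collapse_map x) (collapse_map y).
Proof.
have one a b : ~~ is_head F a && ~~ is_tail F a -> is_head F b || is_tail F b ->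
    madj F a b -> madj (collapse F) (collapse_map a) (collapse_map b).
  move=> Pa hb ab; apply/orP; left; rewrite /uadj /uedges /=.
  have -> : collapse_map a = inl (Sub a Pa) by rewrite /collapse_map insubT.
  rewrite !inE; case/orP: hb => hb; apply/orP.
    rewrite collapse_map_head //; left; apply/orP; right.
    apply/imsetP; exists (Sub a Pa) => //; rewrite inE; apply/existsP; exists b.
    by rewrite hb SubK.
  rewrite collapse_map_tail //; right.
  apply/imsetP; exists (Sub a Pa) => //; rewrite inE; apply/existsP; exists b.
  by rewrite hb SubK.
move=> xy; have [hx|] := boolP (is_head F x || is_tail F x).
  have [hy|] := boolP (is_head F y || is_tail F y); last first.
    by rewrite negb_or madj_sym => ny; apply: one; rewrite // madj_sym.
  case/orP: hx => hx; case/orP: hy => hy.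
  - by have := coll.1 _ _ hx hy; rewrite xy.
  - by rewrite (collapse_map_head hx) (collapse_map_tail hy) madj_sym collapse_th.
  - by rewrite (collapse_map_tail hx) (collapse_map_head hy) collapse_th.
  - by have := coll.2 _ _ hx hy; rewrite xy.
rewrite negb_or => nx; have [hy|] := boolP (is_head F y || is_tail F y).
  exact: one.
rewrite negb_or => ny; apply/orP; left; rewrite /uadj /uedges /=.
have -> : collapse_map x = inl (Sub x nx) by rewrite /collapse_map insubT.
have -> : collapse_map y = inl (Sub y ny) by rewrite /collapse_map insubT.
rewrite !inE; apply/orP; left; apply/orP; left; apply/imsetP.
exists (Sub x nx, Sub y ny) => //; rewrite inE !SubK /=.
case/or3P: xy => // [xy|yx].
  by case/andP: nx => _ /existsP[]; exists y.
by case/andP: ny => _ /existsP[]; exists x.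
Qed.

(** Colour the collapse properly and permute the colours so that t gets [i0] and h gets [j0]. Every
    directed edge of [F] then follows the arc from [i0] to [j0], and any other edge only needs
    distinct indices. *)
Lemma mhom_complete (r : nat) (u d : rel 'I_r) (i0 j0 : 'I_r) :
    (chromatic_number (collapse F) <= r)%N ->
    (forall i j, i != j -> [|| u i j, d i j | d j i]) ->
    i0 != j0 -> d i0 j0 -> mhom F u d.
Proof.
rewrite /chromatic_number; case: ex_minnP => k /existsP[c0 /forallP col0] _ kr ud ij dij.
pose c v := widen_ord kr (c0 v).
have col x y : madj (collapse F) x y -> c x != c y.
  move=> xy; rewrite -(inj_eq val_inj) /= (inj_eq val_inj).
  exact: (implyP (forallP (col0 x) y)).
(* The second transposition does not disturb [i0], because t and h have different colours. *)
pose th := tperm (c (tvertex F)) i0.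
pose s := (th * tperm (th (c (hvertex F))) j0)%g.
have st : s (c (tvertex F)) = i0.
  rewrite permM tpermL tpermD //; last by rewrite eq_sym.
  rewrite -[i0 in _ != i0](tpermL (c (tvertex F)) i0) (inj_eq perm_inj).
  by rewrite eq_sym; exact: col collapse_th.
have sh : s (c (hvertex F)) = j0 by rewrite permM tpermL.
apply/mhomP; exists (fun v => s (c (collapse_map v))) => x y xy.
  apply: ud; rewrite (inj_eq perm_inj); apply: col; apply: collapse_map_adj.
  by rewrite /madj xy.
rewrite collapse_map_tail ?collapse_map_head ?st ?sh //; apply/existsP.
  by exists x.
by exists y.
Qed.

End Collapsible.

(** * Existence of the maxima *)

Lemma finite_is_maximum (R : realType) (S : set R) (s : seq R) (c : R) :
  (forall x, S x -> x \in s) -> S c -> exists m, is_maximum S m.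
Proof.
move=> Ss Sc; exists (\big[Num.max/c]_(x <- s | `[< S x >]) x); split.
  by elim/big_ind: _ => [//|x y Sx Sy|x /asboolP//]; rewrite /Num.max; case: ifP.
by move=> x Sx; apply: le_bigmax_seq; [exact: Ss|exact/asboolP].
Qed.

Section LagrangianMaximum.
Variables (R : realType) (rho : R).

(** Stated for bare relations, it takes finitely many values for each [r], while [madjmx] also
    carries proofs. *)
Definition lagrangian (r : nat) (u d : rel 'I_r) : R :=
  maximum [set \sum_i \sum_j y i 0 * y j 0 * wt rho u d i j | y in @simplex R r]%classic.

Lemma gdensityE (A : madjmx) : gdensity rho A = lagrangian (@mx_urel A) (@mx_drel A).
Proof.
rewrite /gdensity /lagrangian; congr maximum.
by congr image; apply/funext => y; rewrite quad_form.
Qed.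

(** A continuous function on a compact set: the simplex is closed in a cube, and nonempty since
    [0 < r]. Row vectors are the form in which compactness of the cube and the extreme value theorem
    apply. *)
Lemma lagrangian_is_maximum (r : nat) (u d : rel 'I_r) : (0 < r)%N ->
  is_maximum [set \sum_i \sum_j y i 0 * y j 0 * wt rho u d i j | y in @simplex R r]%classic
    (lagrangian u d).
Proof.
move=> r0; apply: xgetPex.
pose D : set 'rV[R]_r := [set v | (forall i, `[0, 1]%classic (v ord0 i)) /\ \sum_i v 0 i = 1]%classic.
pose f (v : 'rV[R]_r) := \sum_i \sum_j v 0 i * v 0 j * wt rho u d i j.
have sumc (I : finType) (g : I -> 'rV[R]_r -> R) :
    (forall i, continuous (g i)) -> continuous (fun v => \sum_i g i v).
  by move=> gc; apply: continuous_big => //; exact: add_continuous.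
have coordc i : continuous (fun v : 'rV[R]_r => v 0 i) by exact: coord_continuous.
have fc : continuous f.
  apply: (sumc) => i; apply: (sumc) => j v.
  apply: (@continuousM _ _ (fun v : 'rV[R]_r => v 0 i * v 0 j) (fun=> _) v); last exact: cst_continuous.
  by apply: (@continuousM _ _ (fun v : 'rV[R]_r => v 0 i) (fun v : 'rV[R]_r => v 0 j)); exact: coordc.
have cD : compact D.
  have -> : D = ([set v : 'rV[R]_r | forall i, `[0, 1]%classic (v ord0 i)] `&`
      (fun v : 'rV[R]_r => \sum_i v 0 i) @^-1` [set x | x = 1])%classic.
    by [].
  apply: compact_closedI.
    by apply: (@rV_compact R r (fun=> `[0, 1]%classic)) => _; exact: segment_compact.
  apply: closed_comp; last exact: closed_eq.
  by move=> v _; apply: sumc.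
have D0 : (D !=set0)%classic.
  exists (\row_j (j == Ordinal r0)%:R); split=> [i|].
    by rewrite mxE; case: (i == _); rewrite /= in_itv /= ?lexx ler01.
  rewrite (bigD1 (Ordinal r0)) //= mxE eqxx big1 ?addr0 // => i /negbTE ri.
  by rewrite mxE ri.
have Dtr y : simplex y -> D y^T.
  move=> [y0 y1]; split=> [i|]; last by under eq_bigr do rewrite mxE.
  by rewrite mxE /= in_itv /= y0 -y1 (bigD1 i) //= lerDl sumr_ge0.
have [v vD vmax] := EVT_max_rV D0 cD (continuous_subspaceT fc).
exists (f v); split.
  move/set_mem: vD => vD; exists v^T.
    by split=> [i|]; [rewrite mxE; have := vD.1 i; rewrite /= in_itv => /andP[]|
      under eq_bigr do rewrite mxE; exact: vD.2].
  by apply: eq_bigr => i _; apply: eq_bigr => j _; rewrite !mxE.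
move=> _ [y ys <-]; have := vmax y^T (mem_set (Dtr _ ys)).
by apply: le_trans; rewrite /f; under [leRHS]eq_bigr do under eq_bigr do rewrite !mxE.
Qed.

Lemma gdensity_is_maximum (A : madjmx) : (0 < msize A)%N ->
  is_maximum [set (y^T *m weight_mx rho A *m y) 0 0 | y in @simplex R (msize A)]%classic
    (gdensity rho A).
Proof.
move=> /(lagrangian_is_maximum (@mx_urel A) (@mx_drel A)); rewrite -gdensityE.
have -> // : [set \sum_i \sum_j y i 0 * y j 0 * wt rho (@mx_urel A) (@mx_drel A) i j
    | y in @simplex R (msize A)]%classic =
  [set (y^T *m weight_mx rho A *m y) 0 0 | y in @simplex R (msize A)]%classic.
by congr image; apply/funext => y; rewrite quad_form.
Qed.

Lemma gdensity_K : 1 <= gdensity rho madjmx_K.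
Proof.
have [_] := @gdensity_is_maximum madjmx_K isT; apply.
exists (const_mx 1); first by split=> [i|]; rewrite ?big_ord1 mxE.
by rewrite quad_form !big_ord1 /wt /mx_urel /mx_drel !mxE /= !mulr0 addr0 !mulr1.
Qed.

Lemma gdensity_bounded_size_finite (N : nat) : exists s : seq R,
  forall A : madjmx, (msize A < N)%N -> gdensity rho A \in s.
Proof.
pose dens r (f : {ffun 'I_r * 'I_r -> bool * bool}) : R :=
  lagrangian (fun i j => (f (i, j)).1) (fun i j => (f (i, j)).2).
exists (flatten [seq map (@dens r) (enum {ffun 'I_r * 'I_r -> bool * bool}) | r <- iota 0 N]).
move=> A AN; rewrite gdensityE; apply/flattenP.
exists (map (@dens (msize A)) (enum {ffun 'I_(msize A) * 'I_(msize A) -> bool * bool})).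
  by apply/mapP; exists (msize A) => //; rewrite mem_iota.
apply/mapP; exists [ffun p => (mx_urel p.1 p.2, mx_drel p.1 p.2)]; first exact: mem_enum.
by rewrite /dens; congr lagrangian; apply/funext => i; apply/funext => j; rewrite ffunE.
Qed.

Lemma MF_is_maximum (V : finType) (F : mgraph V) :
  exists m : R, is_maximum [set gdensity rho B | B in MF F]%classic m.
Proof.
(* The 2 makes room for [madjmx_K], which has size 1, whatever the chromatic number. *)
have [s hs] := gdensity_bounded_size_finite (maxn 2 (chromatic_number (collapse F)).-1.+1).
apply: (finite_is_maximum (s := s) (c := gdensity rho madjmx_K)).
  move=> _ [B [->|[_ Bs _ _ _]] <-]; apply: hs; rewrite leq_max //.
  by apply/orP; right; rewrite ltnS.
by exists madjmx_K; [left|].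
Qed.

End LagrangianMaximum.

(** * The Motzkin-Straus reduction to members of [MF F] *)

Section Reduction.
Variables (R : realType) (rho : R) (V : finType) (F : mgraph V).
Hypothesis coll : collapsible F.
Variables (T : finType) (u d : rel T).
Hypotheses (u_sym : symmetric u) (u_irr : irreflexive u)
  (d_asym : forall x y, d x y -> ~~ d y x) (ud_excl : forall x y, d x y -> ~~ u x y)
  (nF : ~~ mhom F u d).
Implicit Types p : T -> R.

Let Q p : R := \sum_a \sum_b p a * p b * wt rho u d a b.

(** If the support spans no directed edge, all weights there are at most 1 and [Q p] is at most the
    square of the total mass, so [madjmx_K] serves. Otherwise the restriction to the support is
    itself a member of [MF F]. *)
Lemma covering_support_le p :
    (forall a, 0 <= p a) -> \sum_a p a = 1 ->
    (forall a b, p a != 0 -> p b != 0 -> a != b -> [|| u a b, d a b | d b a]) ->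
  exists2 B, MF F B & Q p <= gdensity rho B.
Proof.
move=> p0 p1 cov; pose X := [set a | p a != 0].
have onX (f : T -> R) : (forall a, p a = 0 -> f a = 0) -> \sum_a f a = \sum_(a in X) f a.
  move=> f0; rewrite (bigID (mem X)) /= [X in _ + X]big1 ?addr0 // => a.
  by rewrite inE negbK => /eqP/f0.
have [[[a b] /= [aX bX dab]]|nod] :=
    pselect (exists ab : T * T, [/\ ab.1 \in X, ab.2 \in X & d ab.1 ab.2]); last first.
  exists madjmx_K; first by left.
  apply: le_trans (gdensity_K rho); rewrite -[leRHS]mulr1 -{2}p1 -{1}p1 big_distrlr /=.
  apply: ler_sum => a _; apply: ler_sum => b _; rewrite -[leRHS]mulr1.
  have [->|pa] := eqVneq (p a) 0; first by rewrite !mul0r.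
  have [->|pb] := eqVneq (p b) 0; first by rewrite !(mulr0, mul0r).
  apply: ler_wpM2l; first by rewrite mulr_ge0.
  rewrite /wt; case: (boolP (d a b)) => [dab|_].
    by case: nod; exists (a, b); rewrite !inE.
  by rewrite !mulr0 addr0; case: (u a b).
pose u' : rel 'I_#|X| := fun i j => u (enum_val i) (enum_val j).
pose d' : rel 'I_#|X| := fun i j => d (enum_val i) (enum_val j).
have us' : symmetric u' by move=> i j; exact: u_sym.
have da' i j : d' i j -> ~~ d' j i by exact: d_asym.
have ud' i j : d' i j -> ~~ u' i j by exact: ud_excl.
pose B := rel_mx us' da' ud'.
have cov' (i j : 'I_#|X|) : i != j -> [|| u' i j, d' i j | d' j i].
  move=> ij; have := enum_valP i; have := enum_valP j; rewrite !inE => pj pi.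
  by apply: cov => //; rewrite (inj_eq enum_val_inj).
have nF' : ~~ mhom F u' d'.
  by apply: contra nF; apply: (mhom_comp (f := enum_val)) => i j; rewrite /u' /d' => ->.
have d'ab : d' (enum_rank_in aX a) (enum_rank_in aX b) by rewrite /d' !enum_rankK_in.
exists B.
  right; split.
  - move=> t _; apply: contra nF' => /blowup_mhom; by rewrite rel_mx_urel rel_mx_drel.
  (* With [chi] or more indices, pairwise adjacent and carrying an arc, [mhom_complete] would give
     the excluded homomorphism. *)
  - have : ~~ (chromatic_number (collapse F) <= #|X|)%N.
      apply: contra nF' => kX; apply: (mhom_complete coll kX cov' _ d'ab).
      by apply: contraTneq d'ab => ->; apply/negP => /[dup] /da' /negP.
    by rewrite -ltnNge /=; case: chromatic_number.
  - by move=> i; rewrite mxE /u' u_irr.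
  - by move=> /matrixP/(_ (enum_rank_in aX a) (enum_rank_in aX b)); rewrite !mxE d'ab.
  - move=> i j /cov'; rewrite !mxE; by case/or3P => ->; rewrite ?addn_gt0 ?orbT.
have X0 : (0 < #|X|)%N by apply/card_gt0P; exists a.
have [_] := @gdensity_is_maximum R rho B X0; apply.
exists (\col_(i < #|X|) p (enum_val i)).
  split=> [i|]; first by rewrite mxE.
  under eq_bigr do rewrite mxE.
  by rewrite -(big_enum_val (A := mem X) p) -onX.
rewrite quad_form rel_mx_urel rel_mx_drel /Q onX => [|c pc]; last first.
  by apply: big1 => e _; rewrite pc !mul0r.
rewrite [RHS](big_enum_val (A := mem X) (fun c => \sum_b p c * p b * wt rho u d c b)).
apply: eq_bigr => i _; rewrite [RHS]onX => [|c pc]; last by rewrite pc !(mulr0, mul0r).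
rewrite [RHS](big_enum_val (A := mem X) (fun c => p (enum_val i) * p c * wt rho u d (enum_val i) c)).
by apply: eq_bigr => j _; rewrite !mxE.
Qed.

(** The partial derivative of [Q] in the coordinate [c]. *)
Let L p c : R := \sum_e p e * (wt rho u d c e + wt rho u d e c).

(* Without an edge between [a] and [b], [Q] is affine along [e_a - e_b], so the
   weight of one of them can be moved to the other without decreasing [Q]. *)
Lemma shift_weight p a b : (forall x, 0 <= p x) -> \sum_x p x = 1 ->
    p a != 0 -> p b != 0 -> a != b -> ~~ [|| u a b, d a b | d b a] ->
    L p b <= L p a ->
  exists p', [/\ forall x, 0 <= p' x, \sum_x p' x = 1,
    (#|[set x | p' x != 0%R]| < #|[set x | p x != 0%R]|)%N & Q p <= Q p'].
Proof.
move=> p0 p1 pa pb ab /norP[nu /norP[nd nd']] Lba.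
pose e x : R := (x == a)%:R - (x == b)%:R.
have ba : b != a by rewrite eq_sym.
have sume (f : T -> R) : \sum_x e x * f x = f a - f b.
  rewrite /e; under eq_bigr do rewrite mulrBl.
  rewrite sumrB (bigD1 a) //= eqxx mul1r big1 => [|x /negbTE->]; last by rewrite mul0r.
  by rewrite (bigD1 b) //= eqxx mul1r big1 ?addr0 // => x /negbTE->; rewrite mul0r.
have sume1 : \sum_x e x = 0.
  transitivity (\sum_x e x * 1); last by rewrite (sume (fun=> 1)) subrr.
  by apply: eq_bigr => x _; rewrite mulr1.
have wii c : wt rho u d c c = 0.
  rewrite /wt u_irr; case: (boolP (d c c)) => [/[dup] /d_asym /negP//|_].
  by rewrite !mulr0 addr0.
have wab : wt rho u d a b = 0 by rewrite /wt (negbTE nu) (negbTE nd) !mulr0 addr0.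
have wba : wt rho u d b a = 0 by rewrite /wt u_sym (negbTE nu) (negbTE nd') !mulr0 addr0.
(* All the weight of [b] goes to [a], so [b] leaves the support and nothing enters it. *)
pose p' x := p x + p b * e x.
exists p'; split.
- move=> x; rewrite /p' /e; case: eqP => [->|_]; first by rewrite (negbTE ab) subr0 mulr1 addr_ge0.
  case: eqP => [->|_]; first by rewrite sub0r mulrN1 subrr.
  by rewrite subrr mulr0 addr0.
- by rewrite big_split /= -mulr_sumr sume1 mulr0 addr0.
- apply: proper_card; apply/properP; split.
    apply/fintype.subsetP => x; rewrite !inE /p' /e; case: (eqVneq x a) => [->//|_].
    by case: (eqVneq x b) => [->|_]; [rewrite sub0r mulrN1 subrr eqxx|rewrite subrr mulr0 addr0].
  by exists b; rewrite !inE // /p' /e eqxx (negbTE ba) sub0r mulrN1 subrr eqxx.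
(* The second-order term involves only the weights of pairs from [a] and [b], which are all 0. *)
- have -> : Q p' = Q p + p b * (L p a - L p b); last first.
    by rewrite lerDl mulr_ge0 // subr_ge0.
  pose w := wt rho u d.
  have inner x : \sum_y p' x * p' y * w x y =
      p' x * (\sum_y p y * w x y + p b * (w x a - w x b)).
    rewrite mulrDr -sume !mulr_sumr -big_split /=.
    by apply: eq_bigr => y _; rewrite /p'; ring.
  rewrite /Q (eq_bigr _ (fun x _ => inner x)).
  have outer (f : T -> R) : \sum_x p' x * f x = \sum_x p x * f x + p b * (f a - f b).
    rewrite -sume mulr_sumr -big_split /=; apply: eq_bigr => x _; rewrite /p'; ring.
  rewrite outer /w !wii wab wba.
  have -> : \sum_x p x * (\sum_y p y * wt rho u d x y + p b * (wt rho u d x a - wt rho u d x b)) =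
      \sum_x \sum_y p x * p y * wt rho u d x y +
      p b * (\sum_x p x * wt rho u d x a - \sum_x p x * wt rho u d x b).
    rewrite -sumrB mulr_sumr -big_split /=; apply: eq_bigr => x _.
    rewrite mulrDr mulr_sumr; congr (_ + _); last by ring.
    by apply: eq_bigr => y _; rewrite mulrA.
  have LE c : L p c = \sum_y p y * wt rho u d c y + \sum_x p x * wt rho u d x c.
    by rewrite /L -big_split /=; apply: eq_bigr => x _; rewrite mulrDr.
  rewrite !LE; ring.
Qed.

(** Induction on the size of the support: as long as two of its points are nonadjacent, weight moves
    to the one with the larger derivative. *)
Lemma lagrangian_reduction p :
    (forall a, 0 <= p a) -> \sum_a p a = 1 ->
  exists2 B, MF F B & Q p <= gdensity rho B.
Proof.
have [k] := ubnP #|[set x | p x != 0]|; elim: k p => // k IH p pk p0 p1.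
have [[[a b] /= [pa pb ab nab]]|cov] := pselect (exists ab : T * T,
    [/\ p ab.1 != 0, p ab.2 != 0, ab.1 != ab.2 &
      ~~ [|| u ab.1 ab.2, d ab.1 ab.2 | d ab.2 ab.1]]).
  have [p' [p'0 p'1 p'k Qp']] : exists p', [/\ forall x, 0 <= p' x, \sum_x p' x = 1,
      (#|[set x | p' x != 0%R]| < #|[set x | p x != 0%R]|)%N & Q p <= Q p'].
    case: (lerP (L p b) (L p a)) => [|/ltW] Lab; first exact: shift_weight Lab.
    apply: (shift_weight p0 p1 pb pa _ _ Lab); first by rewrite eq_sym.
    by rewrite u_sym [d b a || _]orbC.
  have [B FB QB] := IH p' (leq_trans p'k pk) p'0 p'1.
  by exists B => //; apply: le_trans QB.
apply: covering_support_le => // a b pa pb ab; apply: contraT => nab.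
by case: cov; exists (a, b).
Qed.

End Reduction.

(** * Scarcity of homomorphic samples in an [F]-free graph *)

(** A greedy choice works: fewer than [#|I|] values are taken when [i] is treated. *)
Lemma distinct_representatives (I T : finType) (A : I -> {set T}) :
  (forall i, #|I| <= #|A i|)%N -> exists2 f : I -> T, injective f & forall i, f i \in A i.
Proof.
move=> IA.
suff [f fi fA] : exists2 f : I -> T, {in enum I &, injective f} & forall i, f i \in A i.
  by exists f => // i j; apply: fi; rewrite mem_enum.
elim: (enum I) (enum_uniq I) => [_|i s IH /= /andP[is_ us]].
  have nonempty i : exists a, a \in A i.
    by apply/card_gt0P; apply: leq_trans (IA i); apply/card_gt0P; exists i.
  by have [f fA] := fin_all_exists nonempty; exists f.
have [f fi fA] := IH us.
have [a aA an] : exists2 a, a \in A i & a \notin map f s.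
  have : ~~ (A i \subset [set x in map f s]).
    apply/negP => /subset_leq_card; rewrite leqNgt => /negP; apply.
    rewrite cardsE; apply: (leq_ltn_trans (card_size _)); rewrite size_map.
    apply: leq_trans (IA i); have : uniq (i :: s) by rewrite /= is_.
    by move/card_uniqP => iss; rewrite -[_.+1]/(size (i :: s)) -iss max_card.
  by case/subsetPn => a aA; rewrite inE => an; exists a.
exists (fun j => if j == i then a else f j) => [j k|j]; last by case: eqP => [->|].
rewrite !inE; case: (eqVneq j i) => [->|ji] /=; case: (eqVneq k i) => [->|ki] //= js ks.
- by move=> E; case/negP: an; rewrite E map_f.
- by move=> E; case/negP: an; rewrite -E map_f.
- exact: fi.
Qed.

Section FewHoms.
Variables (V : finType) (F : mgraph V).

Definition pullback_hom (m n : nat) (G : mgraph 'I_n) : {set {ffun 'I_m -> 'I_n}} :=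
  [set phi : {ffun 'I_m -> 'I_n} |
    mhom F (fun i j => uadj G (phi i) (phi j)) (fun i j => dadj G (phi i) (phi j))].

(** Samples are sorted by a map [c] witnessing the homomorphism. A class [S c] of density above
    [1 / (q C)] contains a complete box, and distinct representatives of its sides embed [F] in [G].
    Summing over the [C] maps gives the bound. *)
Lemma few_pullback_homs (m q : nat) : (0 < m)%N -> (0 < q)%N ->
  exists n0 : nat, forall n (G : mgraph 'I_n), (n0 <= n)%N -> ~~ mgraph_sub F G ->
    (q * #|pullback_hom m G| <= n ^ m)%N.
Proof.
move=> m0 q0; pose C := #|{ffun V -> 'I_m}|.
have C0 : (0 < C)%N by rewrite /C card_ffun card_ord expn_gt0 m0.
(* Sides of size [#|V|.+1] allow distinct representatives and are nonempty even if [V] is empty. *)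
have [|n0 H] := @dense_box 'I_m #|V|.+1 (q * C).
  by rewrite muln_gt0 q0.
exists n0 => n G nn nF.
pose S (c : {ffun V -> 'I_m}) := [set phi : {ffun 'I_m -> 'I_n} |
  [forall x, forall y, uadj F x y ==> madj G (phi (c x)) (phi (c y))] &&
  [forall x, forall y, dadj F x y ==> dadj G (phi (c x)) (phi (c y))]].
have Ssmall c : (q * C * #|S c| <= n ^ m)%N.
  rewrite leqNgt; apply: contra nF => /ltnW dS.
  have [||A At hA] := H 'I_n (S c); rewrite ?card_ord //.
  have [f fi fA] : exists2 f : V -> 'I_n, injective f & forall v, f v \in A (c v).
    by apply: distinct_representatives => v; rewrite At.
  have A0 i : exists a, a \in A i.
    by apply/card_gt0P; rewrite At.
  have [g gA] := fin_all_exists A0.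
  (* To test one edge, a sample of the box is chosen through [f x] and [f y]. If [c x = c y],
     membership in [S c] would give a loop of [G]. *)
  pose phi x y := [ffun i => if i == c x then f x else if i == c y then f y else g i].
  have phiS x y : phi x y \in S c.
    by apply: hA => i; rewrite ffunE; case: eqP => [->//|_]; case: eqP => [->|].
  have phix x y : phi x y (c x) = f x by rewrite ffunE eqxx.
  have phiy x y : c x != c y -> phi x y (c y) = f y.
    by rewrite ffunE eqxx eq_sym => /negbTE ->.
  apply/mgraph_subP; exists f; split=> // x y xy; have := phiS x y; rewrite inE => /andP[hu hd].
    have := implyP (forallP (forallP hu x) y) xy; rewrite phix.
    case: (eqVneq (c x) (c y)) => [<-|/phiy-> //]; by rewrite phix madj_irrefl.
  have := implyP (forallP (forallP hd x) y) xy; rewrite phix.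
  case: (eqVneq (c x) (c y)) => [<-|/phiy-> //]; rewrite phix.
  by move/dadjP => []; rewrite eqxx.
have sub : (#|pullback_hom m G| <= \sum_c #|S c|)%N.
  rewrite card_sum_mem; under [leqRHS]eq_bigr do rewrite card_sum_mem.
  rewrite exchange_big; apply: leq_sum => phi _ /=; rewrite inE.
  case: mhomP => // -[c cu cd]; rewrite (bigD1 [ffun x => c x]) //= inE.
  rewrite (_ : _ && _ = true) //; apply/andP; split;
    apply/forallP => x; apply/forallP => y; apply/implyP; rewrite !ffunE; [exact: cu|exact: cd].
rewrite -(leq_pmul2l C0); apply: (@leq_trans (\sum_c q * C * #|S c|)).
  by rewrite -big_distrr /= mulnCA mulnA leq_mul2l sub orbT.
apply: (@leq_trans (\sum_(c : {ffun V -> 'I_m}) n ^ m)); first by apply: leq_sum.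
by rewrite sum_nat_const.
Qed.

End FewHoms.

(** * Upper bound for [F]-free graphs *)

Section UpperBound.
Variables (R : realType) (rho : R) (V : finType) (F : mgraph V).
Hypotheses (rho1 : 1 < rho) (coll : collapsible F).

Lemma wt_ge0 (T : finType) (u d : rel T) x y : 0 <= wt rho u d x y.
Proof. by rewrite addr_ge0 // mulr_ge0 // (le_trans ler01 (ltW rho1)). Qed.

Lemma wt_le (T : finType) (G : mgraph T) x y : wt rho (uadj G) (dadj G) x y <= 2 * rho.
Proof.
rewrite /wt; case: (boolP (dadj G x y)) => [/dadjP[_ _ /negbTE ->]|_].
  by rewrite add0r mulr1 mulrC.
by rewrite !mulr0 addr0; case: (uadj G x y); rewrite ?mulr1n ?mulr0n; have := rho1; lra.
Qed.

(** The error splits as [2 rho / m] from the fraction [1 / m] of bad samples and [8 rho / m] from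
    replacing [(1 - 1/m)(1 - 1/n)] by 1, using [x <= 4 rho] and [m <= n]. *)
Lemma density_upper (M : R) (m : nat) : (0 < m)%N ->
    (forall B, MF F B -> gdensity rho B <= M) ->
  exists n0 : nat, forall n (G : mgraph 'I_n), (n0 <= n)%N -> ~~ mgraph_sub F G ->
    weight rho G / 'C(n, 2)%:R <= M + 10 * rho / m%:R.
Proof.
move=> m0 hM; have [n0 few] := few_pullback_homs F m0 m0.
have M1 : 1 <= M by apply: le_trans (gdensity_K rho) (hM _ _); left.
exists (maxn n0 (maxn m 2)) => n G; rewrite !geq_max => /and3P[nn mn n2] nF.
have n0' : (0 < n)%N := ltnW n2.
have rho0 : 0 <= rho by rewrite (le_trans ler01) // ltW.
have mR : 0 < m%:R :> R by rewrite ltr0n.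
have nR : 0 < n%:R :> R by rewrite ltr0n.
have mnR : m%:R <= n%:R :> R by rewrite ler_nat.
have n2R : 2 <= n%:R :> R by rewrite ler_nat.
pose h := wt rho (uadj G) (dadj G).
have h0 a b : 0 <= h a b by exact: wt_ge0.
have p1 (k : nat) : (0 < k)%N -> \sum_(a < k) k%:R^-1 = 1 :> R.
  by move=> k0; rewrite sumr_const card_ord -[LHS]mulr_natr mulVf // pnatr_eq0 -lt0n.
pose H (phi : {ffun 'I_m -> 'I_n}) := \sum_i \sum_(j | j != i) h (phi i) (phi j).
have HQ phi : H phi <= \sum_i \sum_j h (phi i) (phi j).
  by apply: ler_sum => i _; rewrite [leRHS](bigD1 i) //= lerDr.
have Hall phi : H phi <= m%:R ^+ 2 * (2 * rho).
  apply: le_trans (HQ phi) _.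
  apply: le_trans (_ : \sum_(i < m) \sum_(j < m) (2 * rho) <= _).
    by apply: ler_sum => i _; apply: ler_sum => j _; exact: wt_le.
  by rewrite !sumr_const !card_ord -!mulrnA -[leLHS]mulr_natl natrM.
(* The reduction is applied to the pulled-back relations with uniform weights [1 / m]. *)
have Hgood phi : phi \notin pullback_hom F m G -> H phi <= m%:R ^+ 2 * M.
  rewrite inE => nphi; apply: le_trans (HQ phi) _.
  have [||||i||B FB QB] := @lagrangian_reduction R rho V F coll 'I_m
      (fun i j => uadj G (phi i) (phi j)) (fun i j => dadj G (phi i) (phi j))
      _ _ _ _ nphi (fun=> m%:R^-1).
  - by move=> i j; exact: uadj_sym.
  - by move=> i; exact: uadj_irrefl.
  - by move=> i j /dadjP[].
  - by move=> i j /dadjP[].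
  - by rewrite invr_ge0 ltW.
  - exact: p1.
  have := le_trans QB (hM _ FB).
  rewrite -(ler_pM2l (x := m%:R ^+ 2)) ?exprn_gt0 //; apply: le_trans.
  rewrite mulr_sumr; apply: ler_sum => i _; rewrite mulr_sumr; apply: ler_sum => j _.
  by rewrite mulrA -expr2 exprVn mulfV ?mul1r // expf_neq0 // gt_eqF.
have samp := sample_sum 'I_m (p1 n n0') h.
have w2 : \sum_(a < n) \sum_(b < n) n%:R^-1 * n%:R^-1 * h a b = 2 * weight rho G / n%:R ^+ 2.
  rewrite weight_sum mulr_suml; apply: eq_bigr => a _; rewrite mulr_suml.
  by apply: eq_bigr => b _; rewrite mulrC -expr2 exprVn.
rewrite w2 card_ord in samp.
have up : m%:R * (m%:R - 1) * (2 * weight rho G / n%:R ^+ 2) <=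
    m%:R ^+ 2 * M + m%:R ^+ 2 * (2 * rho) / m%:R.
  rewrite -samp (eq_bigr (fun phi => n%:R^-1 ^+ m * H phi)) => [|phi _]; last first.
    by rewrite prodr_const card_ord.
  rewrite -mulr_sumr exprVn mulrC ler_pdivrMr ?exprn_gt0 //.
  apply: le_trans (_ : \sum_(phi : {ffun 'I_m -> 'I_n})
      (m%:R ^+ 2 * M + m%:R ^+ 2 * (2 * rho) * (phi \in pullback_hom F m G)%:R) <= _).
    apply: ler_sum => phi _; case: (boolP (phi \in _)) => [_|/Hgood]; last by rewrite mulr0 addr0.
    by rewrite mulr1; apply: le_trans (Hall phi) _; rewrite lerDr mulr_ge0 ?exprn_ge0 // (le_trans ler01).
  rewrite big_split /= sumr_const card_ffun !card_ord -mulr_sumr -natr_sum -card_sum_mem.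
  rewrite [leRHS]mulrDl lerD //; first by rewrite -[leLHS]mulr_natr natrX.
  rewrite -!mulrA !ler_wpM2l ?exprn_ge0 //.
  by rewrite ler_pdivlMl // -natrX -natrM ler_nat few.
set x := weight rho G / 'C(n, 2)%:R.
have cE := natr_bin2 R n0'.
have c0 : 0 < 'C(n, 2)%:R :> R by rewrite ltr0n bin_gt0.
have wx : 2 * weight rho G = x * (n%:R * (n%:R - 1)).
  by rewrite cE /x mulrCA divfK // gt_eqF.
have x0 : 0 <= x.
  by rewrite divr_ge0 // addr_ge0 // mulr_ge0.
(* A crude bound: [n^2] ordered pairs of weight at most [2 rho], and [n <= 2 (n - 1)]. *)
have x4 : x <= 4 * rho.
  have : 2 * weight rho G <= n%:R ^+ 2 * (2 * rho).
    rewrite weight_sum; apply: le_trans (_ : \sum_(i < n) \sum_(j < n) (2 * rho) <= _).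
      by apply: ler_sum => i _; apply: ler_sum => j _; exact: wt_le.
    by rewrite !sumr_const !card_ord -!mulrnA -[leLHS]mulr_natl natrM.
  rewrite wx mulrCA expr2 -mulrA ler_pM2l // => le1.
  have : x * (n%:R - 1) <= (4 * rho) * (n%:R - 1) by nra.
  by rewrite ler_pM2r //; lra.
have frac : x * ((1 - m%:R^-1) * (1 - n%:R^-1)) <= M + 2 * rho / m%:R.
  rewrite -(ler_pM2l (x := m%:R ^+ 2)) ?exprn_gt0 // [leRHS]mulrDr [X in _ <= _ + X]mulrA.
  apply: le_trans up; rewrite wx le_eqVlt; apply/orP; left; apply/eqP.
  by field; rewrite !gt_eqF.
have im : 0 < m%:R^-1 :> R by rewrite invr_gt0.
have inm : n%:R^-1 <= m%:R^-1 :> R by rewrite lef_pV2.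
have in0 : 0 < n%:R^-1 :> R by rewrite invr_gt0.
move: frac; set a := m%:R^-1 in im inm *; set b := n%:R^-1 in inm in0 * => frac; clearbody a b x.
have : x * (a + b) <= 4 * rho * (2 * a) by apply: ler_pM => //; lra.
have : 0 <= x * (a * b) by rewrite !mulr_ge0 // ltW.
lra.
Qed.

End UpperBound.

(** * Members of [MF F] and the conclusion *)

Section MembersOfMF.
Variables (V : finType) (F : mgraph V).
Hypothesis hdir : dedges F != finset.set0.

Lemma MF_size_gt0 B : MF F B -> (0 < msize B)%N.
Proof.
case=> [->//|[_ _ _ D0 _]]; rewrite lt0n; apply/eqP => B0; case: D0.
by apply/matrixP => i; have := ltn_ord i; rewrite {2}B0.
Qed.

(** [madjmx_K] has no arc to receive the directed edge of [F]; for other members, a homomorphism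
    would put [F] in the blow-up with classes of size [#|V|]. *)
Lemma MF_no_hom B : MF F B -> ~~ mhom F (@mx_urel B) (@mx_drel B).
Proof.
have [[x y] xy] := set0Pn _ hdir.
case=> [->|[nF _ _ _ _]].
  by apply/mhomP => -[c _ /(_ x y xy)]; rewrite /mx_drel mxE.
have V0 : (0 < #|V|)%N by apply/card_gt0P; exists x.
by apply: contra (nF _ V0); exact: mhom_blowup.
Qed.

End MembersOfMF.

Unset Implicit Arguments.

Theorem theorem4p11 (R : realType) (rho : R) (hrho : 1 < rho)
    (V : finType) (F : mgraph V) (hdir : dedges F != finset.set0)
    (htheta : (1 < theta R F < +oo)%E) :
  exists2 m : R,
    is_maximum [set gdensity rho B | B in MF F]%classic m &
    limn_esup (fun n =>
      (max_free F (fun G : mgraph 'I_n => weight rho G / 'C(n, 2)%:R))%:E)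
    = m%:E.
Proof.
have coll := theta_collapsible htheta.
have [m mmax] := MF_is_maximum rho F; exists m => //.
have [[B FB gB] ub] := mmax.
have hm B' : MF F B' -> gdensity rho B' <= m by move=> FB'; apply: ub; exists B'.
have m1 : 1 <= m by apply: le_trans (gdensity_K rho) (hm _ _); left.
apply/eqP; rewrite eq_le; apply/andP; split.
  apply/lee_addgt0Pr => e e0; rewrite -EFinD.
  (* The sample size [k] is chosen so that the error [10 rho / k] is below [e]. *)
  pose k := Num.bound (10 * rho / e).
  have k0 : 10 * rho / e < k%:R.
    by apply: archi_boundP; rewrite divr_ge0 ?mulr_ge0 ?(ltW e0) // (le_trans ler01 (ltW hrho)).
  have kR : 0 < k%:R :> R.
    by apply: le_lt_trans k0; rewrite divr_ge0 ?mulr_ge0 ?(ltW e0) // (le_trans ler01 (ltW hrho)).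
  have [|n0 hn0] := density_upper hrho coll (m := k) _ hm; first by rewrite -(ltr0n R).
  apply: (limn_esup_le (N := n0)) => n nn; rewrite /max_free; apply: bigmax_le.
    (* The default 0 of the big maximum must also lie below the bound. *)
    by rewrite addr_ge0 ?(ltW e0) // (le_trans ler01).
  move=> G GF; apply: le_trans (hn0 n G nn GF) _; rewrite lerD2l.
  by rewrite ler_pdivrMr // [leRHS]mulrC -ler_pdivrMr // ltW.
(* The optimal point of the optimal member gives the lower bound for every [n >= 2]. *)
have [[y ys yg] _] := gdensity_is_maximum rho (MF_size_gt0 FB).
apply: (limn_esup_ge (N := 2)) => n n2; rewrite -gB -yg.
exact: max_free_lower n2 ys (MF_no_hom hdir FB).
Qed.
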